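(* Let $q$ be a positive integer. The class of signed bi-graphs that are not $q$-colorable is closed under Operations (sb1), (sb2), (sb3), (sb4) and (sb5)$_q$. That is: if $(G,\sigma)$ is a signed bi-graph that is not $q$-colorable and $(G',\sigma')$ is obtained from $(G,\sigma)$ by one application of (sb1), (sb2), (sb4) or (sb5)$_q$, then $(G',\sigma')$ is not $q$-colorable; and if $(G_1,\sigma_1)$ and $(G_2,\sigma_2)$ are vertex-disjoint signed bi-graphs that are both not $q$-colorable and $(G,\sigma)$ is obtained from them by (sb3), then $(G,\sigma)$ is not $q$-colorable.
   Context: A bi-graph is a loopless multigraph with at most two edges between any two distinct vertices. A signed bi-graph $(G,\sigma)$ is a bi-graph $G$ together with a map $\sigma\colon E(G)\to\{1,-1\}$ such that any two parallel edges have distinct signs; an edge $e$ is positive if $\sigma(e)=1$ and negative otherwise. For distinct vertices $u,v$, $m(u,v)$ is the number of edges joining $u$ and $v$; $u,v$ are adjacent (neighbours) if $m(u,v)\ge 1$. For a positive integer $k$, a $k$-coloring of $(G,\sigma)$ is a map $c\colon V(G)\to\mathbb{Z}_k$ such that $c(v)\neq\sigma(e)c(w)$ for every edge $e$ with ends $v,w$ (where $-x$ is the additive inverse in $\mathbb{Z}_k$); $(G,\sigma)$ is $k$-colorable if it has a $k$-coloring. $(K_n,\pm)$ denotes the bi-complete signed bi-graph on $n$ vertices, i.e. every two distinct vertices are joined by exactly one positive and one negative edge. For an integer $k\ge 0$, a signed bi-graph is $k$-thin if it is obtained from some $(K_n,\pm)$ by deleting at most $k$ pairwise vertex-disjoint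 edges. Switching at a vertex $v$ replaces $\sigma(e)$ by $-\sigma(e)$ for every edge $e$ incident with $v$ and leaves other signs unchanged. The operations (for a positive integer parameter $p$ in (sb5)$_p$): (sb1) Add vertices or signed edges (the result remaining a signed bi-graph). (sb2) Identify two nonadjacent vertices. (sb3) Given two vertex-disjoint signed bi-graphs $(G_1,\sigma_1)$, $(G_2,\sigma_2)$, a vertex $v$ of $G_1$ and a positive edge $e$ of $G_2$ with ends $x,y$: split $v$ into two new vertices $v_1,v_2$ (each edge formerly incident with $v$ becomes incident with exactly one of $v_1,v_2$, keeping its other end and its sign), remove $e$, and identify $v_1$ with $x$ and $v_2$ with $y$. (sb4) Switch at a vertex. (sb5)$_p$ If $p$ is even, remove a vertex that has at most $p/2$ neighbours; if $p$ is odd, remove a negative edge whose ends are joined by no other edge, identify these two ends, and add signed edges so that the resulting signed bi-graph is $\frac{p-3}{2}$-thin. *)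

(* Defs.v *)
From HB Require Import structures.
From mathcomp Require Import all_boot all_order all_algebra.

Set Implicit Arguments.
Unset Strict Implicit.
Unset Printing Implicit Defensive.

(** Finite signed bi-graphs.  Parallel edges have distinct signs, so an edge
    is determined by its two ends and its sign: an edge is encoded as a pair
    [(ends, sign)], the sign [true] meaning positive.  The bound of two edges
    between any two vertices is then automatic. *)

Definition sedge (V : finType) : finType := ({set V} * bool)%type.

Definition ends (V : finType) (e : sedge V) : {set V} := e.1.
Definition positive (V : finType) (e : sedge V) : bool := e.2.
Definition sigma (V : finType) (e : sedge V) : int :=
  if positive e then 1%R else (-1)%R.

Record sbigraph := SBigraph {
  vertices :> finType;
  edges : {set sedge vertices};
  edges_loopless : forall e, e \in edges -> #|ends e| = 2
}.

Definition mult (G : sbigraph) (u v : G) : nat :=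
  #|[set e in edges G | ends e == [set u; v]]|.

Definition adjacent (G : sbigraph) (u v : G) : bool := 1 <= mult u v.

Definition neighbours (G : sbigraph) (v : G) : {set G} :=
  [set w | adjacent v w].

(** The group Z_k is taken to be ['I_k.-1.+1], which is the cyclic group of
    order [k] for every [k > 0] (['Z_1] would be Z/2Z). *)
Definition coloring (k : nat) (G : sbigraph) (c : G -> 'I_k.-1.+1) : Prop :=
  forall (e : sedge G) (v w : G),
    e \in edges G -> ends e = [set v; w] -> c v <> (c w *~ sigma e)%R.

Definition colorable (k : nat) (G : sbigraph) : Prop :=
  exists c : G -> 'I_k.-1.+1, coloring c.

Lemma bicomplete_loopless (V : finType) (e : sedge V) :
  e \in [set e : sedge V | #|ends e| == 2] -> #|ends e| = 2.
Proof. by rewrite inE => /eqP. Qed.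

(** [(K_n, +-)] with [n = #|V|]. *)
Definition bicomplete (V : finType) : sbigraph :=
  SBigraph (@bicomplete_loopless V).

Definition thin (k : nat) (G : sbigraph) : Prop :=
  exists D : {set sedge G},
    [/\ D \subset edges (bicomplete G),
        #|D| <= k,
        {in D &, forall e f, e != f -> [disjoint ends e & ends f]}
      & edges G = edges (bicomplete G) :\: D].

Definition map_edge (V W : finType) (f : V -> W) (e : sedge V) : sedge W :=
  (f @: ends e, e.2).

Definition switch_edge (V : finType) (v : V) (e : sedge V) : sedge V :=
  (ends e, if v \in ends e then ~~ e.2 else e.2).

(** [f] is the quotient map identifying the two vertices [u] and [v] and
    nothing else. *)
Definition identifies (V W : finType) (u v : V) (f : V -> W) : Prop :=
  (forall z, exists x, f x = z) /\
  (forall x y, f x = f y <-> x = y \/ (x \in [set u; v] /\ y \in [set u; v])).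

(** [G'] arises from [G] by splitting [v] into [v1] and [v2]: identifying
    [v1] and [v2] gives back [G], every edge of [G] coming from exactly one
    edge of [G'] (so each edge at [v] goes to exactly one of [v1], [v2]). *)
Definition splits (G G' : sbigraph) (v : G) (v1 v2 : G') : Prop :=
  exists g : G' -> G,
    [/\ v1 != v2 /\ g v1 = v,
        identifies v1 v2 g,
        {in edges G' &, injective (map_edge g)}
      & map_edge g @: edges G' = edges G].

(** The operations are relations on signed bi-graphs; the result is related
    to the input by explicit vertex maps, hence is only fixed up to
    isomorphism.  After an identification of vertices, edges that acquire the
    same ends and the same sign become one edge. *)

Definition sb1 (G H : sbigraph) : Prop :=
  exists f : G -> H, injective f /\ map_edge f @: edges G \subset edges H.

Definition sb2 (G H : sbigraph) : Prop :=
  exists (u v : G) (f : G -> H),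
    [/\ u != v, ~~ adjacent u v, identifies u v f
      & edges H = map_edge f @: edges G].

Definition sb3 (G1 G2 H : sbigraph) : Prop :=
  exists (v : G1) (x y : G2) (e : sedge G2)
         (G1' : sbigraph) (v1 v2 : G1') (h1 : G1' -> H) (h2 : G2 -> H),
    [/\ [/\ e \in edges G2, positive e & ends e = [set x; y]],
        splits v v1 v2,
        injective h1 /\ injective h2,
        (forall z, (exists a, h1 a = z) \/ (exists b, h2 b = z)) /\
        (forall a b, h1 a = h2 b <-> (a = v1 /\ b = x) \/ (a = v2 /\ b = y))
      & edges H =
          (map_edge h1 @: edges G1') :|: (map_edge h2 @: (edges G2 :\ e))].

Definition sb4 (G H : sbigraph) : Prop :=
  exists (v : G) (f : G -> H),
    bijective f /\
    edges H = [set map_edge f (switch_edge v e) | e in edges G].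

Definition sb5_even (p : nat) (G H : sbigraph) : Prop :=
  exists (v : G) (f : H -> G),
    [/\ #|neighbours v| <= p %/ 2,
        injective f,
        (forall x, (exists z, f z = x) <-> x <> v)
      & map_edge f @: edges H = [set e in edges G | v \notin ends e]].

(** Here [k = (p - 3) / 2]; as thinness requires [k >= 0], the operation has
    no outcome when [p = 1]. *)
Definition sb5_odd (p : nat) (G H : sbigraph) : Prop :=
  exists (u v : G) (e : sedge G) (f : G -> H) (k : nat),
    [/\ [/\ e \in edges G, ~~ positive e, ends e = [set u; v]
          & mult u v = 1],
        identifies u v f,
        map_edge f @: (edges G :\ e) \subset edges H,
        p = 2 * k + 3
      & thin k H].

Definition sb5 (p : nat) (G H : sbigraph) : Prop :=
  if odd p then sb5_odd p G H else sb5_even p G H.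

(* Main.v *)
(** For (sb1), (sb2) and (sb4) a coloring of the new graph pulls back to the
    old one.  For (sb3), a coloring of [H] pulls back to [G2 - e]; as [G2] has
    no coloring, the two ends of [e] get the same color, so the colors of the
    split vertices agree and a coloring of [G1] is obtained.

    For (sb5), partition [Z_q] into the classes [{x, -x}], of which there are
    [q/2 + 1] (rounding down).  When [q] is even, at most [q/2] neighbours leave
    some class free for the removed vertex.  When [q = 2k + 3], a coloring of
    [H] can only fail to pull back to [G] if the merged vertex [z] has color
    [0].  Two vertices of [H] in the same class are the ends of a deleted edge,
    so one of the [k + 1] nonzero classes [{a, -a}] contains at most one vertex.
    Recoloring that vertex with [0] and [z] with [a] colors [H] with
    [z] nonzero. *)

Require Import Defs.
From mathcomp Require Import all_boot all_order all_algebra.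
From mathcomp Require Import zify.

Import GRing.Theory.

Lemma map_edge_pair (V W : finType) (f : V -> W) (x y : V) (s : bool) :
  map_edge f ([set x; y], s) = ([set f x; f y], s).
Proof. by rewrite /map_edge /ends /= imsetU !imset_set1. Qed.

Lemma edge_pair (G : sbigraph) (e : sedge G) :
  e \in edges G -> exists x y s, x != y /\ e = ([set x; y], s).
Proof.
case: e => E s /edges_loopless /= /eqP/cards2P[x [y [xy EE]]].
by exists x, y, s; rewrite -EE.
Qed.

Lemma edge_neq (G : sbigraph) (x y : G) (s : bool) :
  ([set x; y], s) \in edges G -> x != y.
Proof. by move/edges_loopless; rewrite /ends /= cards2; case: (x != y). Qed.

Lemma coloringP (k : nat) (G : sbigraph) (c : G -> 'I_k.-1.+1) :
  coloring c <->
  forall x y s, ([set x; y], s) \in edges G ->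
    c x <> (if s then c y else - c y)%R.
Proof.
split=> [cc x y s exy | cc [E s] x y eE /= Exy].
  by have := cc _ x y exy erefl; case: s {exy} => /=.
rewrite /ends /= in Exy; rewrite Exy in eE.
by have := cc x y s eE; rewrite /sigma /=; case: s {eE}.
Qed.

Lemma coloring_pullback (k : nat) (G H : sbigraph) (f : G -> H)
    (c : H -> 'I_k.-1.+1) :
  map_edge f @: edges G \subset edges H -> coloring c ->
  coloring (fun x => c (f x)).
Proof.
move=> fS /coloringP cc; apply/coloringP => x y s exy.
apply: cc; rewrite -map_edge_pair; apply: (subsetP fS); exact: imset_f.
Qed.

Lemma eq_set2P (T : finType) (x y u v : T) :
  [set x; y] = [set u; v] -> (x = u /\ y = v) \/ (x = v /\ y = u).
Proof.
move=> /setP E; have := E x; have := E y; have := E u; have := E v.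
rewrite !inE !eqxx /= ?orbT.
by move=> /orP[]/eqP? /orP[]/eqP? /esym/orP[]/eqP? /esym/orP[]/eqP?; subst; auto.
Qed.

(** Only the edge missing from the image needs a separate check. One orientation of it suffices
    because negation is an involution. *)
Lemma coloring_pullback_but_edge (k : nat) (G H : sbigraph) (f : G -> H)
    (c : H -> 'I_k.-1.+1) (u v : G) (s : bool) :
  map_edge f @: (edges G :\ ([set u; v], s)) \subset edges H -> coloring c ->
  c (f u) <> (if s then c (f v) else - c (f v))%R ->
  coloring (fun x => c (f x)).
Proof.
move=> fS /coloringP cc cuv; apply/coloringP => x y t exy.
have [[E ts]|ne] := eqVneq ([set x; y], t) ([set u; v], s).
  rewrite ts; case: (eq_set2P _ _ _ _ _ E) => [] [-> ->] // E'; apply: cuv.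
  by rewrite E'; case: (s); rewrite ?opprK.
apply: cc; rewrite -map_edge_pair; apply: (subsetP fS); apply: imset_f.
by rewrite in_setD1 ne.
Qed.

(** The class of [x] under negation is indexed by the smaller of [x] and [n.+1 - x], which lies
    between [0] and [n.+1./2]. There is thus one more index than [B] can occupy. *)
Lemma exists_free_class (n : nat) (B : {set 'I_n.+1}) :
  #|B| <= n.+1./2 -> exists x : 'I_n.+1, x \notin B /\ (- x)%R \notin B.
Proof.
move=> leB; pose class (x : 'I_n.+1) : 'I_(n.+1./2).+1 := inord (minn x (n.+1 - x)).
have [i iB] : exists i : 'I_(n.+1./2).+1, i \notin class @: B.
  apply/existsP; rewrite -negb_forall; apply/negP => /forallP all_i.
  have /eqP : class @: B = setT by apply/setP => i; rewrite inE all_i.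
  rewrite eqEcard cardsT card_ord => /andP[_].
  by rewrite leqNgt ltnS (leq_trans (leq_imset_card _ _)).
have ilt : i < n.+1 by have := ltn_ord i; lia.
have classE (x : 'I_n.+1) : x = i :> nat \/ x + i = n.+1 -> class x = i.
  move=> xi; apply: ord_inj; have iN := ltn_ord i.
  by rewrite /class (_ : minn _ _ = i) ?inord_val //; case: xi; lia.
have notB x : class x = i -> x \notin B.
  by move=> xi; apply: contra iB => xB; rewrite -xi imset_f.
exists (inord i); split; apply: notB; apply: classE; rewrite /= inordK //.
  by left.
(* The residue of [n.+1 - i] reduces to [0] when [i] is [0], hence the separate case. *)
case: (posnP i) => [->|i0]; first by left; rewrite subn0 modnn.
by right; rewrite modn_small ?subnK ?ltn_subrL ?i0 // ltnW.
Qed.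

Lemma sb1_colorable (q : nat) (G H : sbigraph) :
  sb1 G H -> colorable q H -> colorable q G.
Proof.
move=> [f [_ fS]] [c cc]; exists (fun x => c (f x)); exact: coloring_pullback cc.
Qed.

Lemma sb2_colorable (q : nat) (G H : sbigraph) :
  sb2 G H -> colorable q H -> colorable q G.
Proof.
move=> [u [v [f [_ _ _ eH]]]] [c cc]; exists (fun x => c (f x)).
by apply: coloring_pullback cc; rewrite eH.
Qed.

Lemma sb4_colorable (q : nat) (G H : sbigraph) :
  sb4 G H -> colorable q H -> colorable q G.
Proof.
move=> [v [f [_ eH]]] [c /coloringP cc].
(* Negating the color at [v] compensates for the sign changes at [v]. *)
exists (fun x => if x == v then - c (f x) else c (f x))%R.
apply/coloringP => x y s exy; have xy := edge_neq _ _ _ _ exy.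
have := cc (f x) (f y) (if v \in [set x; y] then ~~ s else s).
rewrite eH -map_edge_pair => /(_ (imset_f (fun e => map_edge f (switch_edge v e)) exy)).
rewrite !inE ![v == _]eq_sym.
have [xv|_] := eqVneq x v; have [yv|_] := eqVneq y v => //=.
- by rewrite xv yv eqxx in xy.
- by case: (s) => /= cxy E; apply: cxy; rewrite -?E ?opprK //; apply: oppr_inj.
- by case: (s) => /=; rewrite ?opprK.
Qed.

Lemma sb3_colorable (q : nat) (G1 G2 H : sbigraph) :
  sb3 G1 G2 H -> colorable q H -> ~ colorable q G2 -> colorable q G1.
Proof.
move=> [v [x [y [[E s] [G1' [v1 [v2 [h1 [h2]]]]]]]]].
case=> [[eE /= s1 Exy] [g [_ [gsurj gid] _ gE]] _ [_ h12] eH] [c cc] nG2.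
rewrite /ends /positive /= in s1 Exy; rewrite Exy s1 in eE eH.
have cxy : c (h2 x) = c (h2 y).
  apply/eqP/negP => /negP/eqP cxy; apply: nG2; exists (fun z => c (h2 z)).
  by apply: (coloring_pullback_but_edge _ _ _ _ _ x y true _ cc cxy); rewrite eH subsetUr.
have cv : c (h1 v1) = c (h1 v2).
  have -> : h1 v1 = h2 x by apply/h12; left.
  by have -> : h1 v2 = h2 y by apply/h12; right.
(* The coloring is constant on the fibres of [g], so it descends to [G1] whichever preimages [lift]
   chooses. *)
have cg a b : g a = g b -> c (h1 a) = c (h1 b).
  move/gid => [-> //|[]]; rewrite !inE.
  by move=> /orP[]/eqP-> /orP[]/eqP->.
have gsurjb z : exists a, g a == z by have [a <-] := gsurj z; exists a.
have cc1 : coloring (fun a => c (h1 a)).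
  by apply: coloring_pullback cc; rewrite eH subsetUl.
pose lift z := xchoose (gsurjb z).
have liftK z : g (lift z) = z by apply/eqP; exact: (xchooseP (gsurjb z)).
have clift a : c (h1 (lift (g a))) = c (h1 a) by apply: cg; rewrite liftK.
exists (fun z => c (h1 (lift z))); apply/coloringP => z w t.
rewrite -gE => /imsetP[e' e'E]; have [a [b [r [_ e'D]]]] := edge_pair _ _ e'E.
rewrite e'D map_edge_pair => -[zw ->]; rewrite e'D in e'E.
move/coloringP: cc1 => cc1.
case: (eq_set2P _ _ _ _ _ zw) => [] [-> ->]; rewrite !clift; apply: cc1 => //.
by rewrite setUC.
Qed.

Lemma sb5_even_colorable (q : nat) (G H : sbigraph) :
  0 < q -> sb5_even q G H -> colorable q H -> colorable q G.
Proof.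
move=> q0 [v [f [nv finj fim eH]]] [c /coloringP cc].
have fimb z : z != v -> exists a, f a == z.
  by move/eqP/fim => [a <-]; exists a.
(* The default is reached only at [v], where the final coloring uses [m] instead. *)
pose lift (z : G) : 'I_q.-1.+1 := if [pick a | f a == z] is Some a then c a else 0%R.
have liftf a : lift (f a) = c a.
  by rewrite /lift; case: pickP => [b /eqP/finj -> //|/(_ a)]; rewrite eqxx.
have [|m [mB mNB]] := @exists_free_class q.-1 (lift @: neighbours v).
  apply: leq_trans (leq_imset_card _ _) (leq_trans nv _).
  by rewrite prednK // divn2.
have free y s : ([set v; y], s) \in edges G ->
    (lift y <> if s then m else - m)%R.
  move=> evy yE.
  have yN : y \in neighbours v.
    by rewrite inE /adjacent /mult card_gt0; apply/set0Pn; exists ([set v; y], s); rewrite inE evy /=.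
  have := imset_f lift yN; rewrite yE; case: (s); first by rewrite (negPf mB).
  by rewrite (negPf mNB).
exists (fun z => if z == v then m else lift z); apply/coloringP => x y s exy.
have xy := edge_neq _ _ _ _ exy.
have [xv|xv] := eqVneq x v; have [yv|yv] := eqVneq y v.
- by rewrite xv yv eqxx in xy.
- rewrite xv in exy; have := free _ _ exy; case: (s) => // n E; apply: n; rewrite E ?opprK //.
- by rewrite yv setUC in exy; have := free _ _ exy; case: (s).
have : ([set x; y], s) \in [set e in edges G | v \notin ends e].
  by rewrite inE exy /ends /= !inE ![v == _]eq_sym negb_or xv.
rewrite -eH => /imsetP[e' e'E]; have [a [b [r [_ e'D]]]] := edge_pair _ _ e'E.
rewrite e'D map_edge_pair => -[zw ->]; rewrite e'D in e'E.
case: (eq_set2P _ _ _ _ _ zw) => [] [-> ->]; rewrite !liftf; apply: cc => //.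
by rewrite setUC.
Qed.

Lemma thin_recoloring (k : nat) (H : sbigraph) (z : H)
    (c : H -> 'I_(2 * k + 3).-1.+1) :
  thin k H -> coloring c -> c z = 0%R ->
  exists2 c' : H -> 'I_(2 * k + 3).-1.+1, coloring c' & c' z <> 0%R.
Proof.
move=> [D [_ cardD disjD eH]] /coloringP cc cz.
(* One end represents each deleted edge: if both ends have colors in [{a, -a}], either choice
   detects that class. *)
pose rep (e : sedge H) := if [pick w in ends e] is Some w then c w else 0%R.
have deleted x y s : x != y -> c x = (if s then c y else - c y)%R ->
    ([set x; y], s) \in D.
  move=> xy cxy; apply/negP => /negP nD; apply: (cc x y s) => //.
  by rewrite eH !inE nD /ends /= cards2 xy.
(* At most [k + 1] colors are avoided, which is exactly half of [2 * k + 3] rounded down; including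
   [0] makes [a] nonzero. *)
have [|a [aB aNB]] := @exists_free_class (2 * k + 3).-1 (0%R |: rep @: D).
  apply: (@leq_trans k.+1); last by lia.
  rewrite cardsU1; apply: (@leq_add _ _ 1 k); first exact: leq_b1.
  exact: leq_trans (leq_imset_card _ _) cardD.
move: aB aNB; rewrite !inE !negb_or oppr_eq0 => /andP[a0 aD] /andP[_ aND].
pose inA w := (c w == a) || (c w == - a)%R.
have one x y : x != y -> inA x -> inA y -> False.
  rewrite /inA => xy xa ya.
  have [s sD] : exists s, ([set x; y], s) \in D.
    case/orP: xa => /eqP xa; case/orP: ya => /eqP ya.
    - by exists true; apply: deleted => //; rewrite xa.
    - by exists false; apply: deleted => //; rewrite xa ya opprK.
    - by exists false; apply: deleted => //; rewrite xa ya.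
    - by exists true; apply: deleted => //; rewrite xa.
  have : (rep ([set x; y], s) == a) || (rep ([set x; y], s) == - a)%R.
    rewrite /rep /ends /=; case: pickP => [w|/(_ x)]; rewrite !inE ?eqxx //.
    by case/orP => /eqP ->.
  by have rD := imset_f rep sD; case/orP => /eqP E; rewrite E ?(negPf aD) ?(negPf aND) in rD.
(* A second vertex of color [0] would conflict with [z] under both signs, so two parallel edges
   would be in [D], against disjointness. Once [z] is recolored, [0] is therefore free for the
   vertex of class [{a, -a}]. *)
have zero y : y != z -> c y != 0%R.
  move=> yz; apply/eqP => cy.
  have De s : ([set y; z], s) \in D.
    by apply: deleted => //; rewrite cy cz oppr0; case: s.
  have := disjD _ _ (De true) (De false).
  rewrite xpair_eqE andbF => /(_ isT) /disjoint_setI0 /setP /(_ y).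
  by rewrite !inE eqxx.
exists (fun w => if w == z then a else if inA w then 0%R else c w); last first.
  by rewrite eqxx; apply/eqP.
apply/coloringP => x y s exy; have xy := edge_neq _ _ _ _ exy.
have [xz|xz] := eqVneq x z; have [yz|yz] := eqVneq y z.
- by rewrite xz yz eqxx in xy.
- have [_|/norP[ya yNa]] := boolP (inA y).
    by case: (s); rewrite ?oppr0; apply/eqP.
  by case: (s) => E; [rewrite E eqxx in ya | rewrite E opprK eqxx in yNa].
- have [_|/norP[xa xNa]] := boolP (inA x).
    by case: (s) => /esym/eqP; rewrite ?oppr_eq0; apply/negP.
  by case: (s) => E; rewrite E eqxx in xa xNa.
have [xa|_] := boolP (inA x); have [ya|_] := boolP (inA y).
- by case: (one x y).
- by case: (s) => /esym/eqP; rewrite ?oppr_eq0; apply/negP/zero.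
- by case: (s) => /eqP; rewrite ?oppr0; apply/negP/zero.
exact: cc.
Qed.

(** A nonzero fixed point of negation would give [x + x = n.+1], contradicting parity. Hence a
    negative edge whose two ends share a nonzero color is properly colored. *)
Lemma opp_eq_self_odd (n : nat) (x : 'I_n.+1) :
  odd n.+1 -> x = (- x)%R -> x = 0%R.
Proof.
move=> on /(congr1 val) /= xE; apply: val_inj => /=; move: xE.
have := ltn_ord x; case: (posnP x) => // x0 xn.
by rewrite modn_small; lia.
Qed.

Lemma sb5_odd_colorable (q : nat) (G H : sbigraph) :
  sb5_odd q G H -> colorable q H -> colorable q G.
Proof.
move=> [u [v [[E s] [f [k [[_ ns Euv _] [_ fid] fS qE tH]]]]]] [c cc].
rewrite /ends /positive /= in ns Euv; subst E q; move/negPf: ns => ns; subst s.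
have fuv : f u = f v by apply/fid; right; rewrite !inE !eqxx orbT.
have [c' cc' c'z] : exists2 c' : H -> 'I_(2 * k + 3).-1.+1, coloring c' & c' (f v) <> 0%R.
  by have [cz|/eqP] := eqVneq (c (f v)) 0%R; [exact: thin_recoloring cz | exists c].
exists (fun x => c' (f x)).
apply: (coloring_pullback_but_edge _ _ _ _ _ u v false fS cc').
by rewrite fuv => /opp_eq_self_odd c0; apply/c'z/c0; lia.
Qed.

Theorem theorem2p1 (q : nat) (hq : 0 < q) :
  (forall G H : sbigraph,
     ~ colorable q G ->
     (sb1 G H \/ sb2 G H \/ sb4 G H \/ sb5 q G H) ->
     ~ colorable q H) /\
  (forall G1 G2 H : sbigraph,
     ~ colorable q G1 -> ~ colorable q G2 ->
     sb3 G1 G2 H ->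
     ~ colorable q H).
Proof.
split=> [G H nG op cH | G1 G2 H nG1 nG2 op cH]; last first.
  exact/nG1/(sb3_colorable _ _ _ _ op cH nG2).
apply: nG; case: op => [op|[op|[op|]]].
- exact: sb1_colorable op cH.
- exact: sb2_colorable op cH.
- exact: sb4_colorable op cH.
rewrite /sb5; case: ifP => _ op; first exact: sb5_odd_colorable op cH.
exact: sb5_even_colorable op cH.
Qed.
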